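(* For arbitrary $w\in\mathbb{F}$ with $|w|>1$, the linear operator \[ \hat{A}_wx:=\left(k\sum_{j=k}^\infty w^j\left(\frac{x_{j+1}}{j+1}-\frac{x_{j+2}}{j+2}\right)\right)_{k\in\mathbb{N}} \] in the space $(X,\|\cdot\|)$ with domain \[ D(\hat{A}_w):=\left\{x:=(x_k)_{k\in\mathbb{N}}\in X\ \middle|\ \left(w^k\left(\frac{x_{k+2}}{k+2}-\frac{x_{k+1}}{k+1}\right)\right)_{k\in\mathbb{N}}\in l_1\right\} \] is unbounded and chaotic as well as its every power \[ \hat{A}_w^{\,n}x=\left(k\sum_{j=k}^\infty\left[\prod_{m=j}^{j+n-1}w^m\right]\left(\frac{x_{j+n}}{j+n}-\frac{x_{j+1+n}}{j+1+n}\right)\right)_{k\in\mathbb{N}},\quad n\in\mathbb{N}, \] in the space $(X,\|\cdot\|)$ with domain \[ D(\hat{A}_w^{\,n})=\left\{x:=(x_k)_{k\in\mathbb{N}}\in X\ \middle|\ \left(\left[\prod_{j=k}^{k+n-1}w^j\right]\left(\frac{x_{k+1+n}}{k+1+n}-\frac{x_{k+n}}{k+n}\right)\right)_{k\in\mathbb{N}}\in l_1\right\}. \] Furthermore, each $\lambda\in\mathbb{F}$ is an eigenvalue for $\hat{A}_w$ of geometric multiplicity $1$, i.e., \[ \dim\ker(\hat{A}_w-\lambda I)=1. \] In particular, provided the space $(X,\|\cdot\|)$ is complex (i.e., $\mathbb{F}=\mathbb{C}$), $\sigma_p(\hat{A}_w)=\mathbb{C}$.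
   Context: $\mathbb{F}:=\mathbb{R}$ or $\mathbb{F}:=\mathbb{C}$; $\mathbb{N}=\{1,2,3,\dots\}$, $\mathbb{Z}_+=\{0,1,2,\dots\}$; $l_1$ is the space of absolutely summable sequences $(z_k)_{k\in\mathbb{N}}\in\mathbb{F}^{\mathbb{N}}$. $X$ is the separable infinite-dimensional Banach space over $\mathbb{F}$ \[ X:=\Big\{(x_k)_{k\in\mathbb{N}}\in\mathbb{F}^{\mathbb{N}}\ \Big|\ \sum_{k=1}^\infty\Big|\frac{x_{k+1}}{k+1}-\frac{x_k}{k}\Big|<\infty\ \text{and}\ \lim_{k\to\infty}\frac{x_k}{k}=0\Big\} \] with the norm $\|x\|:=\sum_{k=1}^\infty\left|\frac{x_{k+1}}{k+1}-\frac{x_k}{k}\right|$. For a (bounded or unbounded) linear operator $A$ in a (real or complex) Banach space $E$ with domain $D(A)$, powers $A^n$ have their natural domains ($D(A^{n+1})=\{x\in D(A^n)\mid A^nx\in D(A)\}$), $A^0:=I$, and $C^\infty(A):=\bigcap_{n=0}^\infty D(A^n)$. A nonzero vector $x\in C^\infty(A)$ is hypercyclic for $A$ if its orbit $\{A^nx\}_{n\in\mathbb{Z}_+}$ is dense in $E$; $A$ is hypercyclic if it has a hypercyclic vector. A vector $x\in D(A^N)$ with $A^Nx=x$ for some $N\in\mathbb{N}$ is a periodic point of $A$. $A$ is chaotic if it is hypercyclic and its set of periodic points is dense in $E$. For a closed linear operator $A$ in a complex Banach space, the point spectrum $\sigma_p(A)$ is the set of $\lambda\in\mathbb{C}$ for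 which $A-\lambda I$ is not injective (the eigenvalues of $A$). *)

(* Defs.v *)
From HB Require Import structures.
From mathcomp Require Import all_boot all_order all_algebra.
From mathcomp Require Import complex.
From mathcomp Require Import all_classical all_reals all_analysis.

Set Implicit Arguments.
Unset Strict Implicit.
Unset Printing Implicit Defensive.

Import Order.TTheory GRing.Theory Num.Theory.
Import numFieldNormedType.Exports.

Local Open Scope classical_set_scope.
Local Open Scope ring_scope.

Section operators.
Variables (K : numFieldType) (E : normedModType K).

(* The values of [act] outside of [dom] are irrelevant. *)
Record operator := Operator { dom : set E ; act : E -> E }.

Implicit Type A : operator.

Definition linear_operator A :=
  dom A 0 /\
  forall (a : K) x y, dom A x -> dom A y ->
    dom A (a *: x + y) /\ act A (a *: x + y) = a *: act A x + act A y.

Definition bounded_operator A :=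
  exists2 M : K, 0 <= M & forall x, dom A x -> `|act A x| <= M * `|x|.

Definition op_id := Operator setT id.

Fixpoint op_pow A (n : nat) : operator :=
  if n is m.+1 then
    Operator (dom (op_pow A m) `&` act (op_pow A m) @^-1` dom A)
             (act A \o act (op_pow A m))
  else op_id.

Definition smooth_vectors A : set E := \bigcap_n dom (op_pow A n).

Definition orbit A (x : E) : set E := range (fun n => act (op_pow A n) x).

Definition hypercyclic_vector A (x : E) :=
  [/\ x != 0, smooth_vectors A x & dense (orbit A x)].

Definition hypercyclic A := exists x, hypercyclic_vector A x.

Definition periodic_points A : set E :=
  [set x | exists N, [/\ (0 < N)%N, dom (op_pow A N) x &
                         act (op_pow A N) x = x]].

Definition chaotic A := hypercyclic A /\ dense (periodic_points A).

(* A - l I *)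
Definition op_shift A (l : K) := Operator (dom A) (fun x => act A x - l *: x).

Definition op_ker A : set E := [set x | dom A x /\ act A x = 0].

Definition point_spectrum A : set K :=
  [set l | ~ set_inj (dom (op_shift A l)) (act (op_shift A l))].

Definition has_dim (S : set E) (n : nat) :=
  exists e : 'I_n -> E,
    (forall c : 'I_n -> K, \sum_i c i *: e i = 0 -> forall i, c i = 0) /\
    S = range (fun c : 'I_n -> K => \sum_i c i *: e i).

End operators.

(* The two cases F = R and F = C. *)
Inductive base_field := RealField | ComplexField.

Definition scalars (R : realType) (b : base_field) : numFieldType :=
  match b with RealField => R | ComplexField => R[i] end.

(* A sequence (x_k) indexed by k = 1, 2, ... is stored as a function on [nat]
   whose value at [i] is x_(i+1). *)
Section sequences.
Variable F : numFieldType.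

Definition seq1 (f : nat -> F) : nat -> F := fun i => f i.+1.

Definition entry (x : nat -> F) (k : nat) : F := x k.-1.

(* x_k / k *)
Definition ratio (x : nat -> F) (k : nat) : F := entry x k / k%:R.

Definition abs_series (z : nat -> F) : nat -> F := series (fun k => `|z k|).

Definition l1 : set (nat -> F) := [set z | cvgn (abs_series z)].

Definition dratio (x : nat -> F) : nat -> F :=
  seq1 (fun k => ratio x k.+1 - ratio x k).

Definition Xset : set (nat -> F) :=
  [set x | l1 (dratio x) /\ ratio x k @[k --> \oo] --> (0 : F)].

Definition Xnorm (x : nat -> F) : F := limn (abs_series (dratio x)).

End sequences.

Definition monotone_convergence (F : numFieldType) :=
  forall (u : nat -> F) (M : F),
  (forall n, 0 <= u n) -> {homo u : m n / (m <= n)%N >-> m <= n} ->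
  (forall n, u n <= M) -> exists l : F, u @ \oo --> l.

Lemma monotone_convergence_real (R : realType) :
  monotone_convergence (R : numFieldType).
Proof.
move=> u M u0 ndu uM.
have : cvgn (u : nat -> R).
  apply: nondecreasing_is_cvgn => //.
  by exists M => _ [n _ <-].
by move=> cu; exists (limn (u : nat -> R)); exact: cu.
Qed.

Lemma monotone_convergence_complex (R : realType) :
  monotone_convergence (R[i] : numFieldType).
Proof.
move=> u M u0 ndu uM.
have uE n : u n = (complex.Re (u n))%:C%C by rewrite RRe_real// ger0_real.
have cvgRe : cvgn (fun n => complex.Re (u n) : R).
  apply: nondecreasing_is_cvgn.
    by move=> m n /ndu; rewrite lecE => /andP[].
  by exists (complex.Re M) => _ [n _ <-]; have := uM n; rewrite lecE => /andP[].
pose l : (R[i] : numFieldType) := (limn (fun n => complex.Re (u n) : R))%:C%C.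
exists l.
apply/cvgrPdist_lt => e e0.
have eE : e = (complex.Re e)%:C%C by rewrite RRe_real// gtr0_real.
have Re0 : 0 < complex.Re e by rewrite eE ltcR in e0.
move/cvgrPdist_lt : cvgRe => /(_ _ Re0); apply: filterS => n.
by rewrite uE -rmorphB/= normc_def/= expr0n/= addr0 sqrtr_sqr eE ltcR.
Qed.

Lemma monotone_convergence_scalars (R : realType) (b : base_field) :
  monotone_convergence (scalars R b).
Proof.
by case: b; [exact: monotone_convergence_real|
             exact: monotone_convergence_complex].
Qed.

Section limits.
Variable F : numFieldType.
Implicit Types u v z : nat -> F.

Lemma limn_ge0 u : cvgn u -> (forall n, 0 <= u n) -> 0 <= limn u.
Proof.
move=> cu u0.
have uE : (fun n => `|u n|) = u by apply/funext => n; rewrite ger0_norm.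
have : (fun n => `|u n|) @ \oo --> `|limn u| by exact: cvg_norm.
by rewrite uE => /(cvg_lim (@norm_hausdorff F F)) ->.
Qed.

Lemma ler_limn u v :
  cvgn u -> cvgn v -> (forall n, u n <= v n) -> limn u <= limn v.
Proof.
move=> cu cv uv; rewrite -subr_ge0 -limB//.
by apply: limn_ge0 => [|n]; [exact: is_cvgB|rewrite subr_ge0].
Qed.

Lemma abs_series_ge0 z n : 0 <= abs_series z n.
Proof. by rewrite /abs_series /series/= sumr_ge0. Qed.

Lemma abs_series_homo z : {homo abs_series z : m n / (m <= n)%N >-> m <= n}.
Proof.
move=> m n mn; rewrite -subr_ge0 /abs_series sub_series_geq//.
exact: sumr_ge0.
Qed.

Lemma abs_series_le_lim z n : l1 z -> abs_series z n <= limn (abs_series z).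
Proof.
move=> cz; rewrite -subr_ge0.
have -> : limn (abs_series z) - abs_series z n =
    limn (fun m => abs_series z (m + n)%N - abs_series z n).
  apply/esym/(cvg_lim (@norm_hausdorff F F)); apply: cvgB; last exact: cvg_cst.
  by rewrite (cvg_shiftn n (abs_series z)).
apply: limn_ge0 => [|m]; last by rewrite subr_ge0 abs_series_homo// leq_addl.
apply: is_cvgB; last exact: is_cvg_cst.
by apply: (@cvgP _ _ (limn (abs_series z))); rewrite (cvg_shiftn n (abs_series z)).
Qed.

Lemma abs_seriesZ (a : F) z :
  abs_series (fun k => a * z k) = fun n => `|a| * abs_series z n.
Proof.
apply/funext => n; rewrite /abs_series /series/= mulr_sumr.
by apply: eq_bigr => i _; rewrite normrM.
Qed.

Lemma l1Z (a : F) z : l1 z -> l1 (fun k => a * z k).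
Proof. by rewrite /l1/= abs_seriesZ => cz; apply: is_cvgMr. Qed.

Lemma l1D u v : monotone_convergence F ->
  l1 u -> l1 v -> l1 (fun k => u k + v k).
Proof.
move=> mcF cu cv; rewrite /l1/=.
have [|l ul] := mcF (abs_series (fun k => u k + v k))
  (limn (abs_series u) + limn (abs_series v)) (abs_series_ge0 _)
  (@abs_series_homo _); last exact: cvgP ul.
move=> n; apply: le_trans (lerD (abs_series_le_lim n cu)
                                (abs_series_le_lim n cv)).
rewrite /abs_series /series/= -big_split/=.
by apply: ler_sum => i _; exact: ler_normD.
Qed.

Lemma dratioP (a : F) (x y : nat -> F) :
  dratio (a *: x + y) = fun k => a * dratio x k + dratio y k.
Proof.
apply/funext => k; rewrite /dratio /seq1 /ratio /entry/=.
rewrite -[(a *: x + y) k.+1]/(a * x k.+1 + y k.+1).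
rewrite -[(a *: x + y) k]/(a * x k + y k).
by rewrite mulrBr !mulrDl !mulrA opprD addrACA.
Qed.

Lemma ratioP (a : F) (x y : nat -> F) :
  ratio (a *: x + y) = fun k => a * ratio x k + ratio y k.
Proof.
apply/funext => k; rewrite /ratio /entry.
rewrite -[(a *: x + y) k.-1]/(a * x k.-1 + y k.-1).
by rewrite mulrDl mulrA.
Qed.

Lemma Xset0 : Xset (0 : nat -> F).
Proof.
have r0 : ratio (0 : nat -> F) = fun=> 0 by apply/funext => k; exact: mul0r.
split; rewrite /= ?r0; last exact: cvg_cst.
have -> : dratio (0 : nat -> F) = fun k => 0 * 0.
  by apply/funext => k; rewrite /dratio /seq1 r0 subr0 mul0r.
by rewrite /l1/= abs_seriesZ; under eq_fun do rewrite normr0 mul0r; exact: is_cvg_cst.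
Qed.

End limits.

Section space_X.
Variables (R : realType) (b : base_field).
Notation F := (scalars R b).

Definition Xpred : {pred nat -> F} := fun x => `[< Xset x >].

Lemma Xpred_submod_closed : submod_closed Xpred.
Proof.
split=> [|a x y /asboolP[lx cx] /asboolP[ly cy]]; apply/asboolP.
  exact: Xset0.
split.
  rewrite dratioP; apply: l1D => //; first exact: monotone_convergence_scalars.
  exact: l1Z.
rewrite ratioP -[0](addr0 (0 : F)) -{1}(mulr0 a).
by apply: cvgD => //; exact: cvgMr.
Qed.

HB.instance Definition _ :=
  GRing.isSubmodClosed.Build F (nat -> F) Xpred Xpred_submod_closed.

Record X := MkX { Xseq :> nat -> F ; _ : Xseq \in Xpred }.

HB.instance Definition _ := [isSub for Xseq].
HB.instance Definition _ := [Choice of X by <:].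
HB.instance Definition _ := [SubChoice_isSubLmodule of X by <:].

Let norm_X (x : X) : F := Xnorm x.

Let XP (x : X) : Xset x. Proof. by apply/asboolP; exact: (valP x). Qed.

Let ler_norm_XD x y : norm_X (x + y) <= norm_X x + norm_X y.
Proof.
have [lx _] := XP x; have [ly _] := XP y; have [lxy _] := XP (x + y).
rewrite /norm_X /Xnorm -limD//; apply: ler_limn => //; first exact: is_cvgD.
move=> n; rewrite -[(x + y : X) : nat -> F]/((x : nat -> F) + (y : nat -> F)).
rewrite -[(x : nat -> F)]scale1r dratioP scale1r.
rewrite -[leRHS]/(abs_series _ n + abs_series _ n).
rewrite /abs_series /series/= -big_split/=.
by apply: ler_sum => i _; rewrite mul1r; exact: ler_normD.
Qed.

Let norm_XZ (l : F) x : norm_X (l *: x) = `|l| * norm_X x.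
Proof.
have [lx _] := XP x.
rewrite /norm_X /Xnorm -[(l *: x : X) : nat -> F]/(l *: (x : nat -> F)).
have -> : dratio (l *: (x : nat -> F)) = fun k => l * dratio x k.
  rewrite -[_ *: _]addr0 dratioP; apply/funext => k.
  by rewrite /dratio /seq1 /ratio /entry /= !mul0r subr0 addr0.
by rewrite abs_seriesZ; apply/cvg_lim => //; exact: cvgMr.
Qed.

Let norm_X_eq0 x : norm_X x = 0 -> x = 0.
Proof.
have [lx rx] := XP x => nx0.
have d0 k : dratio x k = 0.
  apply/eqP; rewrite -normr_le0; apply: (@le_trans _ _ (abs_series (dratio x) k.+1)).
    by rewrite /abs_series /series/= big_nat_recr//= lerDr sumr_ge0.
  by rewrite -[leRHS]nx0; exact: abs_series_le_lim.
have rE k : ratio x k.+1 = ratio x 1.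
  elim: k => // k <-; apply/eqP; rewrite -subr_eq0; apply/eqP; exact: d0.
have r1 : ratio x 1 = 0.
  have : ratio x (k + 1)%N @[k --> \oo] --> (0 : F) by rewrite (cvg_shiftn 1%N).
  under eq_fun do rewrite addn1 rE.
  by move/(cvg_lim (@norm_hausdorff F F)) => <-; rewrite lim_cst.
apply/val_inj/funext => k /=.
have /eqP := rE k; rewrite r1 /ratio /entry/= mulf_eq0 invr_eq0 pnatr_eq0 orbF.
by move/eqP.
Qed.

HB.instance Definition _ :=
  Lmodule_isNormed.Build F X ler_norm_XD norm_XZ norm_X_eq0.

Lemma normXE (x : X) : `|x| = Xnorm x.
Proof. by []. Qed.

Variable w : F.

Definition Ahat_term (x : nat -> F) (j : nat) : F :=
  w ^+ j * (ratio x j.+1 - ratio x j.+2).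

Definition Ahat_seq (x : nat -> F) : nat -> F :=
  seq1 (fun k => k%:R * \big[+%R/0]_(k <= j <oo) Ahat_term x j).

Definition Ahat_dom : set X :=
  [set x : X | l1 (seq1 (fun k => w ^+ k * (ratio x k.+2 - ratio x k.+1)))].

(* [insubd 0] sends a sequence that is not in X to 0; that [Ahat_seq x] is in X
   for x in [Ahat_dom] has to be proved. *)
Definition Ahat : operator X :=
  Operator Ahat_dom (fun x : X => insubd (0 : X) (Ahat_seq x)).

Definition Ahat_pow_term (n : nat) (x : nat -> F) (j : nat) : F :=
  (\prod_(j <= m < j + n) w ^+ m) * (ratio x (j + n) - ratio x (j + 1 + n)).

Definition Ahat_pow_seq (n : nat) (x : nat -> F) : nat -> F :=
  seq1 (fun k => k%:R * \big[+%R/0]_(k <= j <oo) Ahat_pow_term n x j).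

Definition Ahat_pow_dom (n : nat) : set X :=
  [set x : X | l1 (seq1 (fun k =>
    (\prod_(k <= j < k + n) w ^+ j) *
    (ratio x (k + 1 + n) - ratio x (k + n))))].

End space_X.

(* Main.v *)
(** Put [c_k = w^(-(1 + ... + k))] and let [u_k] be the [k]-th difference of
    [x_j / j] divided by [c_k]. Then [x |-> u] identifies [X] with the weighted
    space [l1(c)], and the operator becomes the plain backward shift with its
    maximal domain, so its [n]-th power is the shift by [n] places. As [c]
    decays faster than any geometric sequence, [l1(c)] contains all sequences of
    exponential growth. Hence every geometric sequence is an eigenvector,
    periodic sequences are dense periodic points, and a sequence listing the
    finite words over a countable dense set of scalars, far enough apart, is
    hypercyclic. *)
Require Import Defs.
From mathcomp Require Import all_boot all_order all_algebra.
From mathcomp Require Import complex.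
From mathcomp Require Import all_classical all_reals all_analysis.

Set Implicit Arguments.
Unset Strict Implicit.
Unset Printing Implicit Defensive.

Import Order.TTheory GRing.Theory Num.Theory.
Import numFieldNormedType.Exports.

Local Open Scope classical_set_scope.
Local Open Scope ring_scope.

(** * Absolutely convergent scalar series *)

Definition absolutely_convergent_cvg (F : numFieldType) :=
  forall z : nat -> F, l1 z -> cvgn (series z).

Lemma absolutely_convergent_cvg_real (R : realType) :
  absolutely_convergent_cvg (R : numFieldType).
Proof. by move=> z lz; exact: (@normed_cvg R R). Qed.

Section complex_scalars.
Variable R : realType.
Local Open Scope complex_scope.
Notation C := (R[i] : numFieldType).

(** In the order of [R[i]] a positive [e] is real, so bounding each of the two parts by half of
    [complex.Re e] suffices, by the triangle inequality. *)
Lemma normc_lt (z e : C) : `|complex.Re z| < complex.Re e / 2 ->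
  `|complex.Im z| < complex.Re e / 2 -> 0 < e -> `|z| < e.
Proof.
move=> rz iz e0.
have -> : e = (complex.Re e)%:C by rewrite RRe_real// gtr0_real.
have -> : z = (complex.Re z)%:C + 'i%C * (complex.Im z)%:C.
  by case: z {rz iz} => x y; rewrite -complexE.
apply: (le_lt_trans (ler_normD _ _)); rewrite normrM.
have -> : `|'i%C : C| = 1 by rewrite normc_def/= expr0n/= expr1n add0r sqrtr1.
rewrite mul1r !normc_def/= !expr0n/= !addr0 !sqrtr_sqr -rmorphD/= ltcR.
by rewrite (splitr (complex.Re e)); exact: ltrD.
Qed.

Lemma Re_half_gt0 (e : C) : 0 < e -> 0 < complex.Re e / 2.
Proof. by move=> e0; rewrite divr_gt0// -ltcR RRe_real// gtr0_real. Qed.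

Lemma cvg_complex (u : nat -> C) (a b : R) :
  (fun n => complex.Re (u n) : R) @ \oo --> a ->
  (fun n => complex.Im (u n) : R) @ \oo --> b ->
  u @ \oo --> (a +i* b : C).
Proof.
move=> ua ub; apply/cvgrPdist_lt => e e0; have re0 := Re_half_gt0 e0.
move/cvgrPdist_lt : ua => /(_ _ re0) ua.
move/cvgrPdist_lt : ub => /(_ _ re0) ub.
apply: filterS2 ua ub => n; case: (u n) => x y xa yb.
exact: normc_lt.
Qed.

Lemma absolutely_convergent_cvg_complex : absolutely_convergent_cvg C.
Proof.
move=> z lz.
(* Both parts are additive and do not increase the modulus, so their real series are dominated by
   [abs_series z]. *)
have part (p : {additive R[i] -> R}) : (forall x : C, (`|p x|)%:C <= `|x|) ->
    cvgn (fun n => p (series z n) : R).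
  move=> px.
  have -> : (fun n => p (series z n) : R) = series (p \o z).
    by apply/funext => n; rewrite /series/= raddf_sum.
  apply: normed_cvg; apply: nondecreasing_is_cvgn.
    by apply: nondecreasing_series => n _ _; exact: normr_ge0.
  exists (complex.Re (limn (abs_series z))) => _ [n _ <-].
  have : ((\sum_(0 <= k < n) `|p (z k)|)%:C : C) <= limn (abs_series z).
    apply: le_trans (abs_series_le_lim n lz); rewrite rmorph_sum/=.
    exact: ler_sum.
  by rewrite lecE/= => /andP[].
apply: (@cvgP _ _ (_ +i* _ : C)); apply: cvg_complex.
- apply: (part (@complex.Re R)) => x; exact: normc_ge_Re.
- apply: (part (@complex.Im R)) => -[a b]; rewrite /= normc_def/= lecR.
  by rewrite -sqrtr_sqr ler_wsqrtr// lerDr sqr_ge0.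
Qed.

End complex_scalars.

Lemma absolutely_convergent_cvg_scalars (R : realType) (b : base_field) :
  absolutely_convergent_cvg (scalars R b).
Proof.
by case: b; [exact: absolutely_convergent_cvg_real|
             exact: absolutely_convergent_cvg_complex].
Qed.

(** * A countable dense set of scalars *)

Definition dense_sequence (F : numFieldType) (g : nat -> F) :=
  forall z e : F, 0 < e -> exists n, `|z - g n| < e.

Lemma dense_sequence_real (R : realType) :
  exists g : nat -> R, dense_sequence g.
Proof.
(* The rationals, listed by their codes; a number that codes no rational gives 0. *)
exists (fun n => ratr (odflt 0 (unpickle n : option rat))) => z e e0.
have [q] : exists q, ratr q \in `]z - e, z + e[.
  by apply: rat_in_itvoo; rewrite ltrD2l (lt_trans _ e0)// oppr_lt0.
rewrite in_itv/= => /andP[h1 h2]; exists (pickle q); rewrite pickleK/=.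
by rewrite distrC ltr_distl h1 h2.
Qed.

Lemma dense_sequence_scalars (R : realType) (b : base_field) :
  exists g : nat -> scalars R b, dense_sequence g.
Proof.
have [g gP] := dense_sequence_real R.
case: b; first by exists g.
pose h n : R[i] := if unpickle n is Some (i, j) then Complex (g i) (g j) else 0.
exists h => z e e0; have re0 := Re_half_gt0 e0.
have [i gi] := gP (complex.Re z) _ re0.
have [j gj] := gP (complex.Im z) _ re0.
exists (pickle (i, j)); rewrite /h pickleK.
by case: z gi gj => x y gi gj; exact: normc_lt.
Qed.

(** * Summability tests and tail estimates *)

Section absolute_series.
Variable F : numFieldType.
Hypothesis mcF : Defs.monotone_convergence F.
Implicit Types (u v z : nat -> F) (a q M e : F).

Lemma abs_seriesS z n : abs_series z n.+1 = abs_series z n + `|z n|.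
Proof. by rewrite /abs_series /series/= big_nat_recr. Qed.

Lemma l1_bounded u M : (forall n, abs_series u n <= M) -> l1 u.
Proof.
move=> uM.
have [l ul] := mcF (abs_series_ge0 u) (abs_series_homo u) uM.
exact: cvgP ul.
Qed.

Lemma l1_le u v : l1 v -> (forall k, `|u k| <= `|v k|) -> l1 u.
Proof.
move=> lv uv; apply: (@l1_bounded _ (limn (abs_series v))) => n.
apply: le_trans (abs_series_le_lim n lv).
by rewrite /abs_series /series/=; exact: ler_sum.
Qed.

Lemma limn_abs_series_le u M :
  l1 u -> (forall n, abs_series u n <= M) -> limn (abs_series u) <= M.
Proof.
move=> lu uM; rewrite -[leRHS](@lim_cst _ (@norm_hausdorff F F) nat \oo _ M).
by apply: ler_limn => //; exact: is_cvg_cst.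
Qed.

Lemma norm_le_limn_abs_series u k : l1 u -> `|u k| <= limn (abs_series u).
Proof.
move=> lu; apply: le_trans (abs_series_le_lim k.+1 lu).
by rewrite abs_seriesS lerDr abs_series_ge0.
Qed.

Lemma l1_tail z e : l1 z -> 0 < e ->
  exists L, forall n, (L <= n)%N -> limn (abs_series z) - abs_series z n < e.
Proof.
move=> lz e0; have /cvgrPdist_lt /(_ _ e0) [L _ zL] := lz.
exists L => n Ln; have := zL n Ln; rewrite /= ger0_norm// subr_ge0.
exact: abs_series_le_lim.
Qed.

Lemma limn_abs_series_tail_le u v L : l1 v ->
  (forall k, (k < L)%N -> u k = 0) -> (forall k, `|u k| <= `|v k|) ->
  limn (abs_series u) <= limn (abs_series v) - abs_series v L.
Proof.
move=> lv u0 uv; apply: limn_abs_series_le => [|n]; first exact: l1_le uv.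
have uE0 : abs_series u L = 0.
  rewrite /abs_series /series/= big_nat big1// => k /= kL.
  by rewrite u0 ?normr0.
have [nL|Ln] := leqP n L.
  by rewrite (le_trans (abs_series_homo u nL))// uE0 subr_ge0 abs_series_le_lim.
apply: (@le_trans _ _ (abs_series v n - abs_series v L)); last first.
  by rewrite lerB// abs_series_le_lim.
rewrite -[abs_series u n]subr0 -uE0 /abs_series !sub_series_geq ?(ltnW Ln)//.
exact: ler_sum.
Qed.

(** From [K] on, the partial sum plus the geometric majorant [|u_n| / (1 - q)] of the remainder does
    not increase with n; its value at [K] bounds all partial sums. *)
Lemma l1_ratio_test u q K : 0 <= q < 1 ->
  (forall k, (K <= k)%N -> `|u k.+1| <= q * `|u k|) -> l1 u.
Proof.
move=> /andP[q0 q1] uq; have q1' : 0 < 1 - q by rewrite subr_gt0.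
pose M := abs_series u K + `|u K| / (1 - q).
have step n : abs_series u (K + n) + `|u (K + n)%N| / (1 - q) <= M.
  elim: n => [|n]; first by rewrite addn0.
  apply: le_trans; rewrite addnS abs_seriesS -addrA lerD2l.
  apply: (@le_trans _ _ (`|u (K + n)%N| + q * `|u (K + n)%N| / (1 - q))).
    by rewrite lerD2l ler_pM2r ?invr_gt0// uq// leq_addr.
  rewrite -[X in X + _](@mulfK _ (1 - q)) ?gt_eqF// -mulrDl.
  rewrite ler_pM2r ?invr_gt0//.
  by rewrite mulrBr mulr1 mulrC subrK.
apply: (@l1_bounded _ M) => n.
apply: le_trans (abs_series_homo u (leq_addl K n)) _.
by apply: le_trans (step n); rewrite lerDl divr_ge0// ltW.
Qed.

(** If the powers were bounded, they would have a limit [l = a * l], hence [l = 0], although every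
    power is at least 1. [M] is taken real because the order is only partial and the failure of
    [M < a ^+ n] has to give [a ^+ n <= M]. *)
Lemma exp_unbounded a M : 1 < a -> M \is Num.real -> exists n, M < a ^+ n.
Proof.
move=> a1 Mr; apply: contrapT => /forallNP aM.
have a0 : 0 < a by exact: lt_trans a1.
have aM' n : a ^+ n <= M.
  have [//|Ma] := real_leP (gtr0_real (exprn_gt0 n a0)) Mr.
  by case: (aM n).
have [|n|l al] := mcF (u := GRing.exp a) (M := M) _ _ aM'.
- by move=> n; rewrite exprn_ge0// ltW.
- by move=> m mn; rewrite ler_eXn2l.
have al' : GRing.exp a @ \oo --> a * l.
  rewrite -(cvg_shiftS (GRing.exp a)); under eq_fun do rewrite exprS.
  exact: cvgMr.
have lE : l = a * l.
  rewrite -[RHS](cvg_lim (@norm_hausdorff F F) al').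
  by rewrite (cvg_lim (@norm_hausdorff F F) al).
have : (a - 1) * l = 0 by rewrite mulrBl mul1r -lE subrr.
move/eqP; rewrite mulf_eq0 subr_eq0 gt_eqF//= => /eqP l0.
have : 1 <= l.
  rewrite -(cvg_lim (@norm_hausdorff F F) al).
  rewrite -[leLHS](@lim_cst _ (@norm_hausdorff F F) nat \oo _ (1 : F)).
  apply: ler_limn; [exact: is_cvg_cst|exact: cvgP al|].
  by move=> n; rewrite exprn_ege1// ltW.
by rewrite l0 ler10.
Qed.

End absolute_series.

(** * [X] as a weighted l1 space, and the operator as a shift *)

Section weighted_shift.
Variables (R : realType) (b : base_field).
Notation F := (scalars R b).
Variable w : F.
Hypothesis hw : 1 < `|w|.
Implicit Types (u v : nat -> F) (x y : X R b) (B : operator (X R b)).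

Let mcF : Defs.monotone_convergence F := @monotone_convergence_scalars R b.
Let acF : absolutely_convergent_cvg F := @absolutely_convergent_cvg_scalars R b.

Lemma base_neq0 : w != 0.
Proof. by rewrite -normr_gt0 (lt_trans _ hw). Qed.

(* Chosen so that [weight k = w ^+ k.+1 * weight k.+1]: this makes the operator
   an unweighted shift on the coefficients [coef]. *)
Definition weight (k : nat) : F := \prod_(i < k) (w ^+ i.+1)^-1.

Lemma weightS k : weight k.+1 = weight k / w ^+ k.+1.
Proof. by rewrite /weight big_ord_recr. Qed.

Lemma weight_neq0 k : weight k != 0.
Proof.
apply/prodf_neq0 => i _.
by rewrite invr_neq0// expf_neq0// base_neq0.
Qed.

Lemma norm_weightS_le k : `|weight k.+1| <= `|weight k|.
Proof.
rewrite weightS normrM normfV normrX ler_pdivrMr ?exprn_gt0 ?(lt_trans _ hw)//.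
by rewrite ler_peMr// exprn_ege1// ltW.
Qed.

(** Telescoping: the factor in the formula for the n-th power is the quotient of two weights, which
    dividing by [weight] therefore cancels. *)
Lemma prod_weight n j :
  \prod_(j.+1 <= m < j.+1 + n) w ^+ m * weight (j + n) = weight j.
Proof.
elim: n => [|n IH]; first by rewrite !addn0 big_geq// mul1r.
rewrite addnS big_nat_recr ?leq_addr//= -mulrA addnS weightS -IH.
by rewrite addSn [X in _ * X]mulrC divfK ?expf_neq0 ?base_neq0.
Qed.

Definition wl1 u := l1 (fun k => weight k * u k).

(** The ratio of consecutive terms of [weight k * r ^+ k] has modulus [r / |w| ^+ k.+1], which is at
    most 1/2 once [|w| ^+ k] exceeds [2 * r]. *)
Lemma wl1_exp u (M r : F) : 0 <= r -> (forall k, `|u k| <= M * r ^+ k) -> wl1 u.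
Proof.
move=> r0 uM.
have [K rK] := exp_unbounded mcF hw (ger0_real (mulr_ge0 (ler0n F 2) r0)).
have lr : l1 (fun k => weight k * r ^+ k).
  apply: (@l1_ratio_test _ mcF _ 2^-1 K).
    by rewrite invr_ge0 ler0n/= invf_lt1// ltr1n.
  move=> k Kk; rewrite weightS !normrM normfV !normrX (ger0_norm r0).
  rewrite [r ^+ k.+1]exprS.
  rewrite [leRHS](_ : _ = `|weight k| / `|w| ^+ k.+1 *
      ((2^-1 * `|w| ^+ k.+1) * r ^+ k)); last first.
    have W0 : `|w| ^+ k.+1 != 0 by rewrite expf_neq0// gt_eqF// (lt_trans _ hw).
    rewrite [2^-1 * `|w| ^+ _]mulrC -[X in _ = _ * X]mulrA [RHS]mulrA divfK//.
    by rewrite mulrCA.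
  apply: ler_wpM2l; first by rewrite divr_ge0// exprn_ge0.
  apply: ler_wpM2r; first by rewrite exprn_ge0.
  rewrite mulrC ler_pdivlMr// mulrC (le_trans (ltW rK))//.
  by rewrite ler_eXn2l// (leq_trans Kk).
apply: (@l1_le _ mcF _ (fun k => M * (weight k * r ^+ k))); first exact: l1Z.
move=> k; rewrite mulrCA normrM [leRHS]normrM ler_wpM2l//.
apply: le_trans (uM k) _.
by rewrite real_ler_norm// (ger0_real (le_trans _ (uM k))).
Qed.

Lemma wl1_bounded u (M : F) : (forall k, `|u k| <= M) -> wl1 u.
Proof.
by move=> uM; apply: (@wl1_exp _ M 1) => // k; rewrite expr1n mulr1.
Qed.

(** The weights decrease in modulus, and one more initial term does not affect summability. Hence
    the domain condition for a power of a shift implies those for the lower powers. *)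
Lemma wl1_unshift n u : wl1 (fun k => u (k + n)%N) -> wl1 u.
Proof.
elim: n => [|n IH]; first by under eq_fun do rewrite addn0.
move=> lu; apply: IH.
have lu' : l1 (fun k => weight k.+1 * u (k + n.+1)%N).
  apply: l1_le lu _ => // k; rewrite !normrM ler_wpM2r//.
  exact: norm_weightS_le.
apply: (@cvgP _ _ (`|weight 0 * u n| +
                   limn (abs_series (fun k => weight k.+1 * u (k + n.+1)%N)))).
rewrite -cvg_shiftS; under eq_fun => m.
  rewrite /abs_series /series/= big_nat_recl//= add0n.
  under eq_bigr do rewrite addSnnS.
  over.
by apply: cvgD; [exact: cvg_cst|exact: lu'].
Qed.

(** Indices start at 0: [dratio x k] is the difference of x_j / j between j = k + 1 and j = k +
    2. *)
Definition coef x (k : nat) : F := dratio x k / weight k.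

Lemma coefK x k : weight k * coef x k = dratio x k.
Proof. by rewrite mulrC divfK// weight_neq0. Qed.

Lemma Xset_X x : Xset x.
Proof. by apply/asboolP; exact: (valP x). Qed.

Lemma wl1_coef x : wl1 (coef x).
Proof. by rewrite /wl1; under eq_fun do rewrite coefK; case: (Xset_X x). Qed.

Lemma norm_coef x : `|x| = limn (abs_series (fun k => weight k * coef x k)).
Proof. by rewrite normXE /Xnorm; under eq_fun do rewrite coefK. Qed.

Lemma coefD (a : F) x y k : coef (a *: x + y) k = a * coef x k + coef y k.
Proof.
rewrite /coef -[(a *: x + y : X R b) : nat -> F]/
  (a *: (x : nat -> F) + (y : nat -> F)).
by rewrite dratioP mulrDl mulrA.
Qed.

Lemma coef0 k : coef 0 k = 0.
Proof.
rewrite -[X in coef X k](subrr (0 : X R b)) -scaleN1r addrC coefD.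
by rewrite mulN1r addNr.
Qed.

Lemma coefZ a x k : coef (a *: x) k = a * coef x k.
Proof. by rewrite -[a *: x]addr0 coefD coef0 addr0. Qed.

Lemma coefB x y k : coef (x - y) k = coef x k - coef y k.
Proof. by rewrite addrC -scaleN1r coefD mulN1r addrC. Qed.

Lemma coef_inj x y : coef x =1 coef y -> x = y.
Proof.
move=> xy; apply/eqP; rewrite -subr_eq0 -normr_eq0 norm_coef.
under eq_fun do rewrite coefB xy subrr mulr0.
rewrite (_ : abs_series _ = fun=> 0) ?(lim_cst (@norm_hausdorff F F))//.
apply/funext => n; rewrite /abs_series /series/= big1// => k _.
by rewrite normr0.
Qed.

(** The inverse of [coef]: x_j / j has prescribed differences and limit 0, so it is minus a tail of
    their series, that is, a partial sum minus the total. *)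
Definition seq_of_coef u (i : nat) : F :=
  i.+1%:R * (series (fun k => weight k * u k) i -
             limn (series (fun k => weight k * u k))).

Lemma ratio_seq_of_coef u i : Defs.ratio (seq_of_coef u) i.+1 =
  series (fun k => weight k * u k) i - limn (series (fun k => weight k * u k)).
Proof. by rewrite /Defs.ratio /entry/= mulrC mulKf// pnatr_eq0. Qed.

Lemma dratio_seq_of_coef u : dratio (seq_of_coef u) = fun k => weight k * u k.
Proof.
apply/funext => k; rewrite /dratio /seq1 !ratio_seq_of_coef.
by rewrite opprB addrA subrK /series/= big_nat_recr//= addrC addKr.
Qed.

Lemma Xset_seq_of_coef u : wl1 u -> Xset (seq_of_coef u).
Proof.
move=> lu; split; first by rewrite dratio_seq_of_coef.
rewrite -cvg_shiftS; under eq_fun do rewrite ratio_seq_of_coef.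
set z := fun k => weight k * u k.
have : (fun n => series z n - limn (series z)) @ \oo -->
    limn (series z) - limn (series z).
  by apply: cvgB; [exact: acF|exact: cvg_cst].
by rewrite subrr.
Qed.

(** The default value 0 is taken when [seq_of_coef u] is not in [X]; the lemmas below assume
    [wl1 u], which excludes this. *)
Definition X_of_coef u : X R b := insubd 0 (seq_of_coef u).

Lemma X_of_coefE u : wl1 u -> (X_of_coef u : nat -> F) = seq_of_coef u.
Proof.
by move=> lu; apply: insubdK; apply/asboolP; exact: Xset_seq_of_coef.
Qed.

Lemma X_of_coefK u : wl1 u -> coef (X_of_coef u) =1 u.
Proof.
move=> lu k; rewrite /coef X_of_coefE// dratio_seq_of_coef mulrC mulKf//.
exact: weight_neq0.
Qed.

(** The sign is the one in [seq_of_coef]: a null sequence is minus the sum of its later differences.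
    The series in the operator thus rebuilds a vector from shifted coefficients. *)
Lemma Ahat_pow_termE n (x : nat -> F) j : Ahat_pow_term w n x j.+1 =
  - (weight j * (dratio x (j + n) / weight (j + n))).
Proof.
rewrite /Ahat_pow_term -(prod_weight n j) -[X in _ = - X]mulrA.
rewrite [weight _ * _]mulrC divfK ?weight_neq0// -[RHS]mulrN.
by rewrite /dratio /seq1 opprB addn1 !addSn.
Qed.

Lemma Ahat_pow_domE n x :
  Ahat_pow_dom w n x <-> wl1 (fun k => coef x (k + n)%N).
Proof.
rewrite /Ahat_pow_dom /= /wl1.
suff -> : seq1 (fun k => (\prod_(k <= j < k + n) w ^+ j) *
    (Defs.ratio x (k + 1 + n) - Defs.ratio x (k + n))) =
  fun k => weight k * coef x (k + n)%N by [].
apply/funext => k; rewrite /seq1 /coef -(prod_weight n k) -[RHS]mulrA.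
congr (_ * _); rewrite mulrC divfK ?weight_neq0//.
by rewrite /dratio /seq1 addn1 !addSn.
Qed.

Section power_series.
Variables (n : nat) (x : X R b).
Hypothesis lx : wl1 (fun k => coef x (k + n)%N).
Let z k := weight k * coef x (k + n)%N.

Lemma Ahat_pow_sum_cvg k :
  (fun N => \sum_(k.+1 <= j < N) Ahat_pow_term w n x j) @ \oo -->
  series z k - limn (series z).
Proof.
rewrite -cvg_shiftS.
have H : (fun N => series z k - series z N) @ \oo -->
    series z k - limn (series z).
  by apply: cvgB; [exact: cvg_cst|exact: acF].
(* The two sequences need only agree from [N = k] on; before that the sum is empty. *)
apply: cvg_trans H; apply: near_eq_cvg; near=> N.
have kN : (k <= N)%N by near: N; exists k.
rewrite -opprB sub_series_geq//= big_add1/= -sumrN.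
by apply: eq_bigr => j _; rewrite Ahat_pow_termE.
Unshelve. all: by end_near. Qed.

Lemma Ahat_pow_seqE :
  Ahat_pow_seq w n x = seq_of_coef (fun k => coef x (k + n)%N).
Proof.
apply/funext => i; rewrite /Ahat_pow_seq /seq1 /seq_of_coef; congr (_ * _).
by apply/cvg_lim; [exact: norm_hausdorff|exact: Ahat_pow_sum_cvg].
Qed.

End power_series.

Lemma Ahat_pow_term1 (x : nat -> F) : Ahat_pow_term w 1 x = Ahat_term w x.
Proof.
by apply/funext => j; rewrite /Ahat_pow_term /Ahat_term !addn1 big_nat1.
Qed.

Lemma Ahat_pow_seq1 (x : nat -> F) : Ahat_pow_seq w 1 x = Ahat_seq w x.
Proof. by rewrite /Ahat_pow_seq Ahat_pow_term1. Qed.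

Lemma Ahat_pow_dom1 : @Ahat_pow_dom R b w 1 = Ahat_dom w.
Proof.
apply/funext => x; rewrite /Ahat_pow_dom /Ahat_dom/=.
by under eq_fun do rewrite /seq1 !addn1 big_nat1.
Qed.

(** The only property of the operator used from here on. It passes to powers, so the operator and
    its powers are treated together; [act B] is constrained on the domain alone. *)
Definition shift_operator (N : nat) B :=
  forall x, (dom B x <-> wl1 (fun k => coef x (k + N)%N)) /\
            (dom B x -> act B x = X_of_coef (fun k => coef x (k + N)%N)).

Lemma shift_operator_coef N B x k : shift_operator N B -> dom B x ->
  coef (act B x) k = coef x (k + N)%N.
Proof.
move=> SB Bx; have [Bl ->//] := SB x.
by rewrite X_of_coefK//; exact/Bl.
Qed.

Lemma shift_operator_Ahat : shift_operator 1 (Ahat w).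
Proof.
move=> x; rewrite /= -Ahat_pow_dom1; split; first exact: Ahat_pow_domE.
by move=> /Ahat_pow_domE lx; rewrite /X_of_coef -Ahat_pow_seqE// Ahat_pow_seq1.
Qed.

Lemma shift_operator_pow N B n :
  shift_operator N B -> shift_operator (n * N) (op_pow B n).
Proof.
move=> SB; elim: n => [x|n IH x] /=.
  have xE : coef x = fun k => coef x (k + 0)%N.
    by apply/funext => k; rewrite addn0.
  split; first by rewrite -xE; split => // _; exact: wl1_coef.
  move=> _; rewrite -xE; apply: coef_inj => k.
  by rewrite X_of_coefK//; exact: wl1_coef.
have [dP aP] := IH x; have [dP' aP'] := SB (act (op_pow B n) x).
have coefE : dom (op_pow B n) x ->
    (fun k => coef (act (op_pow B n) x) (k + N)%N) =
    fun k => coef x (k + n.+1 * N)%N.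
  move=> Bx; apply/funext => k.
  by rewrite (shift_operator_coef _ IH)// mulSn addnA.
split.
  split => [[Bx /dP']|lx]; first by rewrite coefE.
  have Bx : dom (op_pow B n) x.
    by apply/dP/(@wl1_unshift N); under eq_fun do rewrite -addnA -mulSn.
  by split=> //=; apply/dP'; rewrite coefE.
by move=> [Bx /= /aP' ->]; rewrite coefE.
Qed.

End weighted_shift.

(** * Linearity and unboundedness of shift operators *)

Section chaos.
Variables (R : realType) (b : base_field).
Notation F := (scalars R b).
Variable w : F.
Hypothesis hw : 1 < `|w|.
Implicit Types (u v : nat -> F) (x y : X R b) (B : operator (X R b)).

Let mcF : Defs.monotone_convergence F := @monotone_convergence_scalars R b.

Lemma dense_dist (S : set (X R b)) :
  (forall x (e : F), 0 < e -> exists2 y, S y & `|x - y| < e) -> dense S.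
Proof.
move=> Sd O [x Ox] oO.
have /nbhs_ballP[e /= e0 eO] : nbhs x O by exact: open_nbhs_nbhs.
have [y Sy xy] := Sd x e e0; exists y; split=> //.
by apply: eO; rewrite -ball_normE.
Qed.

(** The common estimate for truncations, periodic points and orbits: agreement up to [L] leaves only
    a tail of the majorant [v]. *)
Lemma norm_sub_tail x y v L (e : F) : wl1 w v ->
  limn (abs_series (fun k => weight w k * v k)) -
    abs_series (fun k => weight w k * v k) L < e ->
  (forall k, (k < L)%N -> coef w x k = coef w y k) ->
  (forall k, `|coef w x k - coef w y k| <= `|v k|) ->
  `|x - y| < e.
Proof.
move=> lv ve xyL xyv; apply: le_lt_trans ve; rewrite (norm_coef hw).
apply: limn_abs_series_tail_le => // k.
  by move=> kL; rewrite coefB xyL// subrr mulr0.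
by rewrite coefB !normrM ler_wpM2l.
Qed.

Lemma linear_shift_operator N B : shift_operator w N B -> linear_operator B.
Proof.
move=> SB; split=> [|a x y Bx By].
  have [-> _] := SB 0; under eq_fun do rewrite coef0.
  by apply: (@wl1_bounded _ _ _ hw _ 0) => k; rewrite normr0.
have Bxy : dom B (a *: x + y).
  have [-> _] := SB (a *: x + y); rewrite /wl1.
  have [[/(_ Bx) lx _] _] := SB x; have [[/(_ By) ly _] _] := SB y.
  have := l1D mcF (l1Z (a := a) lx) ly; congr l1; apply/funext => k.
  by rewrite coefD mulrDr mulrCA.
split=> //; apply: (coef_inj hw) => k.
by rewrite coefD !(shift_operator_coef hw _ SB)// coefD.
Qed.

Lemma norm_weightD_le j m : `|weight w (j + m)| <= `|weight w j|.
Proof.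
elim: m => [|m IH]; first by rewrite addn0.
by rewrite addnS (le_trans (norm_weightS_le hw _)).
Qed.

Definition unit_coef (j k : nat) : F := (k == j)%:R.

Lemma wl1_unit_coef j : wl1 w (unit_coef j).
Proof.
apply: (@wl1_bounded _ _ _ hw _ 1) => k.
by rewrite /unit_coef; case: eqP; rewrite ?normr1 ?normr0.
Qed.

Lemma norm_unit_coef j : `|X_of_coef w (unit_coef j)| = `|weight w j|.
Proof.
rewrite (norm_coef hw).
under eq_fun do rewrite (X_of_coefK hw (@wl1_unit_coef j)).
apply/eqP; rewrite eq_le; apply/andP; split.
  apply: limn_abs_series_le => [|n]; first exact: wl1_unit_coef.
  suff -> : abs_series (fun k => weight w k * unit_coef j k) n =
      if (j < n)%N then `|weight w j| else 0 by case: ifP.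
  elim: n => [|n IH]; first by rewrite /abs_series /series/= big_geq.
  rewrite abs_seriesS IH /unit_coef ltnS.
  by case: (ltngtP j n) => [_|_|->];
    rewrite ?mulr0 ?mulr1 ?normr0 ?addr0 ?add0r.
have := @norm_le_limn_abs_series _ _ j (@wl1_unit_coef j).
by rewrite /unit_coef eqxx mulr1.
Qed.

(** The unit vector at [n + N] is sent to the one at [n], and the norm grows by a factor of at least
    [|w| ^+ n.+1]. *)
Lemma unbounded_shift_operator N B : (0 < N)%N -> shift_operator w N B ->
  ~ bounded_operator B.
Proof.
move=> N0 SB [M M0 BM].
have [n Mn] := exp_unbounded mcF hw (ger0_real M0).
pose x := X_of_coef w (unit_coef (n + N)).
have xE : (fun k => coef w x (k + N)) = unit_coef n.
  apply/funext => k; rewrite X_of_coefK//; last exact: wl1_unit_coef.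
  by rewrite /unit_coef eqn_add2r.
have Bx : dom B x by have [-> _] := SB x; rewrite xE; exact: wl1_unit_coef.
have := BM x Bx; have [_ /(_ Bx) ->] := SB x.
rewrite xE !norm_unit_coef; apply/negP.
rewrite -real_ltNge ?normr_real//; last first.
  by rewrite realM ?normr_real ?ger0_real.
apply: (@le_lt_trans _ _ (M * (`|weight w n| / `|w| ^+ n.+1))).
  rewrite ler_wpM2l//; case: N N0 {SB xE Bx x} => // N _.
  rewrite addnS -addSn (le_trans (norm_weightD_le _ _))// weightS.
  by rewrite normrM normfV normrX.
have w0 : 0 < `|w| by exact: lt_trans hw.
rewrite mulrCA gtr_pMr ?normr_gt0 ?weight_neq0// ltr_pdivrMr ?exprn_gt0// mul1r.
by rewrite (lt_le_trans Mn)// ler_eXn2l.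
Qed.

(** * Dense periodic points and a hypercyclic vector *)

Section words.
Variable g : nat -> F.
Hypothesis gd : dense_sequence g.

(** The letters are indices into [g], so that a word is a list of numbers and has a code. *)
Definition word (s : seq nat) (k : nat) : F :=
  if (k < size s)%N then g (nth 0%N s k) else 0.

Lemma word_bounded s : exists2 M : F, 0 <= M & forall k, `|word s k| <= M.
Proof.
exists (abs_series (word s) (size s)) => [|k]; first exact: abs_series_ge0.
have [ks|ks] := ltnP k (size s); last first.
  by rewrite /word ltnNge ks/= normr0 abs_series_ge0.
apply: le_trans (abs_series_homo (word s) ks).
by rewrite abs_seriesS lerDr abs_series_ge0.
Qed.

Lemma wl1_word s : wl1 w (word s).
Proof. by have [M _ sM] := word_bounded s; exact: wl1_bounded sM. Qed.

(** First the coefficients are cut off at [L], then each of the remaining ones is replaced by a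
    nearby value of [g]. *)
Lemma word_dense x (e : F) : 0 < e ->
  exists s, `|x - X_of_coef w (word s)| < e.
Proof.
move=> e0; have e20 : 0 < e / 2 by rewrite divr_gt0.
have l1w : wl1 w (fun=> 1).
  by apply: (@wl1_bounded _ _ _ hw _ 1) => k; rewrite normr1.
pose W := limn (abs_series (fun k => weight w k * 1)).
have W0 : 0 < W.
  have := @norm_le_limn_abs_series _ _ 0 l1w; apply: lt_le_trans.
  by rewrite mulr1 normr_gt0 weight_neq0.
(* A uniform error of this size in the coefficients costs at most [e / 2 / 2] in norm; the extra
   factor 1/2 restores a strict inequality after passing to the limit. *)
have d0 : 0 < e / 2 / 2 / W by rewrite !divr_gt0.
have [f fP] := choice (fun k => gd (coef w x k) d0).
have [L Ltail] := l1_tail (wl1_coef hw (x := x)) e20.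
pose s := map f (iota 0 L); exists s.
pose u k := if (k < L)%N then coef w x k else 0.
have lu : wl1 w u.
  apply: (@l1_le _ mcF _ _ (wl1_coef hw (x := x))) => k.
  rewrite normrM [leRHS]normrM ler_wpM2l//.
  by rewrite /u; case: ifP => _; rewrite ?normr0 ?lexx.
rewrite (splitr e) -(subrK (X_of_coef w u) x) -addrA.
apply: (le_lt_trans (ler_normD _ _)); apply: ltrD.
  apply: (@norm_sub_tail _ _ (coef w x) L) => //; first exact: wl1_coef.
  - exact: Ltail.
  - by move=> k kL; rewrite X_of_coefK// /u kL.
  - move=> k; rewrite X_of_coefK// /u; case: ifP => _; last by rewrite subr0.
    by rewrite subrr normr0.
apply: (@le_lt_trans _ _ (e / 2 / 2)); last first.
  by rewrite ltr_pdivrMr// ltr_pMr// ltr1n.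
rewrite (norm_coef hw).
under eq_fun do rewrite coefB (X_of_coefK hw lu) (X_of_coefK hw (@wl1_word s)).
have le k :
    `|weight w k * (u k - word s k)| <= e / 2 / 2 / W * `|weight w k * 1|.
  rewrite normrM mulrC mulr1 ler_wpM2r//.
  rewrite /u /word size_map size_iota; case: ifP => kL; last first.
    by rewrite subrr normr0 ltW.
  by rewrite (nth_map 0%N) ?size_iota// nth_iota// add0n ltW.
have le' n : abs_series (fun k => weight w k * (u k - word s k)) n <= e / 2 / 2.
  apply: (@le_trans _ _
    (e / 2 / 2 / W * abs_series (fun k => weight w k * 1) n)).
    by rewrite /abs_series /series/= mulr_sumr; exact: ler_sum.
  apply: (@le_trans _ _ (e / 2 / 2 / W * W)); last by rewrite divfK// gt_eqF.
  by rewrite ler_wpM2l ?(ltW d0)//; exact: abs_series_le_lim.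
by apply: limn_abs_series_le (le'); exact: l1_bounded le'.
Qed.

Lemma dense_periodic_points N B : (0 < N)%N -> shift_operator w N B ->
  dense (periodic_points B).
Proof.
move=> N0 SB; apply: dense_dist => x e e0.
have e20 : 0 < e / 2 by rewrite divr_gt0.
have [s xs] := word_dense x e20.
have [M M0 sM] := word_bounded s.
have lM : wl1 w (fun=> M + M).
  by apply: (@wl1_bounded _ _ _ hw _ `|M + M|).
have [L Ltail] := l1_tail lM e20.
(* The period [n * N] is at least [L], beyond which the constant majorant [M + M] has a tail below
   [e / 2]. *)
pose n := (size s + L).+1.
have nN : (n <= n * N)%N by rewrite leq_pmulr.
pose u k := word s (k %% (n * N)).
have lu : wl1 w u by apply: (@wl1_bounded _ _ _ hw _ M) => k; exact: sM.
have uE : (fun k => coef w (X_of_coef w u) (k + n * N)%N) = u.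
  by apply/funext => k; rewrite X_of_coefK// /u modnDr.
exists (X_of_coef w u).
  exists n; have [SBd SBa] := shift_operator_pow hw n SB (X_of_coef w u).
  have d : dom (op_pow B n) (X_of_coef w u) by apply/SBd; rewrite uE.
  by split=> //; rewrite SBa// uE.
rewrite (splitr e) -(subrK (X_of_coef w (word s)) x) -addrA.
apply: (le_lt_trans (ler_normD _ _)); apply: ltrD; first exact: xs.
apply: (norm_sub_tail lM (Ltail (n * N)%N _)).
- by rewrite (leq_trans _ nN)// leqW// leq_addl.
- move=> k kn; rewrite !X_of_coefK//; last exact: wl1_word.
  by rewrite /u modn_small.
- move=> k; rewrite !X_of_coefK//; last exact: wl1_word.
  rewrite (ger0_norm (addr_ge0 M0 M0)) (le_trans (ler_normB _ _))// lerD//.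
  exact: sM.
Qed.

(* The word with code [logn 2 t] is written from position [2 ^ t * N] on; each
   word is thus written at infinitely many places. Entries of modulus larger
   than [t] are dropped, which keeps the growth of the coefficients linear. *)
Definition universal_coef (N m : nat) : F :=
  let t := trunc_log 2 (m %/ N) in
  let z := word (odflt [::] (unpickle (logn 2 t))) (m - 2 ^ t * N) in
  if `|z| <= t%:R then z else 0.

Lemma natr_le_exp2 n : n%:R <= 2 ^+ n :> F.
Proof. by rewrite -natrX ler_nat ltnW// ltn_expl. Qed.

(** The cut-off gives the bound [t <= m]. It is weakened to a power because [2 ^+ (k + n)] splits
    into the form required by [wl1_exp] after a shift. *)
Lemma norm_universal_coef N m : `|universal_coef N m| <= 2 ^+ m.
Proof.
rewrite /universal_coef; set t := trunc_log _ _; set z := word _ _.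
apply: (@le_trans _ _ t%:R); first by case: ifP => //; rewrite normr0.
apply: le_trans (natr_le_exp2 m); rewrite ler_nat.
apply: leq_trans (leq_div m N).
have [mN|mN] := posnP (m %/ N); first by rewrite /t mN trunc_log0.
by apply: leq_trans (trunc_logP (isT : (1 < 2)%N) mN); exact/ltnW/ltn_expl.
Qed.

Lemma wl1_universal_coef_shift N n :
  wl1 w (fun k => universal_coef N (k + n)).
Proof.
apply: (@wl1_exp _ _ _ hw _ (2 ^+ n) 2) => // k.
by rewrite -exprD addnC norm_universal_coef.
Qed.

Lemma universal_coefE N s K : (0 < N)%N -> exists2 t, (K <= t)%N &
  forall k, (k < 2 ^ t * N)%N -> universal_coef N (k + 2 ^ t * N) = word s k.
Proof.
move=> N0; have [M M0 sM] := word_bounded s.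
have [i Mi] := exp_unbounded mcF (ltr1n F 2) (ger0_real M0).
(* As [j] is odd, the exponent of 2 in [t] is exactly the code of [s]. As [j] is large, [t] exceeds
   [K] and also [M], so no entry of the word is dropped. *)
pose j := ((2 ^ i + K).*2.+1)%N; pose t := (2 ^ pickle s * j)%N.
have jt : (j <= t)%N by rewrite leq_pmull// expn_gt0.
have Kt : (2 ^ i + K <= t)%N.
  by apply: leq_trans jt; rewrite /j -addnn ltnW// ltnS leq_addr.
exists t => [|k kt]; first by apply: leq_trans Kt; exact: leq_addl.
have logt : logn 2 t = pickle s.
  rewrite lognM ?expn_gt0// pfactorK// logn_coprime ?addn0//.
  by rewrite coprime2n /j /= odd_double.
rewrite /universal_coef.
have -> : trunc_log 2 ((k + 2 ^ t * N) %/ N) = t.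
  apply: trunc_log_eq => //; rewrite addnC divnMDl// leq_addr/=.
  by rewrite expnS mul2n -addnn ltn_add2l ltn_divLR.
rewrite logt pickleK/= addnK ifT// (le_trans (sM k))// (le_trans (ltW Mi))//.
by rewrite -natrX ler_nat (leq_trans _ Kt)// leq_addr.
Qed.

Lemma hypercyclic_shift_operator N B : (0 < N)%N -> shift_operator w N B ->
  hypercyclic B.
Proof.
move=> N0 SB; pose x0 := X_of_coef w (universal_coef N).
have l0 : wl1 w (universal_coef N).
  by have := @wl1_universal_coef_shift N 0; under eq_fun do rewrite addn0.
have x0E n : (fun k => coef w x0 (k + n)%N) = fun k => universal_coef N (k + n).
  by apply/funext => k; rewrite X_of_coefK.
have smooth n : dom (op_pow B n) x0.
  have [-> _] := shift_operator_pow hw n SB x0.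
  by rewrite x0E; exact: wl1_universal_coef_shift.
have d_orbit x (e : F) : 0 < e -> exists2 y, Defs.orbit B x0 y & `|x - y| < e.
  move=> e0; have e20 : 0 < e / 2 by rewrite divr_gt0.
  have [s xs] := word_dense x e20.
  have [M M0 sM] := word_bounded s.
  (* After [2 ^ t] steps the first [2 ^ t * N] coefficients are those of the word. For later [k] the
     shift length is at most [k], so the universal coefficient is at most [2 ^+ (k + k)], and [M] is
     at most [4 ^+ k]. This majorant is independent of [t], so [L] can be fixed before [t]. *)
  pose v k : F := 2 * 4 ^+ k.
  have v0 k : 0 <= v k by rewrite mulr_ge0// exprn_ge0.
  have lv : wl1 w v.
    by apply: (@wl1_exp _ _ _ hw _ 2 4) => // k; rewrite ger0_norm.
  have [L Ltail] := l1_tail lv e20.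
  have [i Mi] := exp_unbounded mcF (ltr1n F 2) (ger0_real M0).
  have [t Kt tE] := universal_coefE s (L + i) N0.
  have pt : (t <= 2 ^ t * N)%N.
    by rewrite (leq_trans (ltnW (ltn_expl t (isT : 1 < 2)%N)))// leq_pmulr.
  exists (act (op_pow B (2 ^ t)) x0); first by exists (2 ^ t)%N.
  rewrite (splitr e) -(subrK (X_of_coef w (word s)) x) -addrA.
  apply: (le_lt_trans (ler_normD _ _)); apply: ltrD; first exact: xs.
  have actE k : coef w (act (op_pow B (2 ^ t)) x0) k =
      universal_coef N (k + 2 ^ t * N).
    rewrite (shift_operator_coef hw _ (shift_operator_pow hw _ SB))//.
    by rewrite X_of_coefK.
  apply: (norm_sub_tail lv (Ltail (2 ^ t * N)%N _)).
  - by rewrite (leq_trans _ pt)// (leq_trans _ Kt)// leq_addr.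
  - by move=> k kt; rewrite X_of_coefK ?actE ?tE//; exact: wl1_word.
  move=> k; rewrite X_of_coefK ?actE//; last exact: wl1_word.
  have [kt|kt] := ltnP k (2 ^ t * N)%N; first by rewrite tE// subrr normr0.
  rewrite (ger0_norm (v0 k)) (le_trans (ler_normB _ _))// /v mulr_natl mulr2n.
  apply: lerD.
    rewrite (le_trans (sM k))// (le_trans (ltW Mi))//.
    rewrite (@le_trans _ _ (2 ^+ k))//.
      rewrite ler_eXn2l ?ltr1n// (leq_trans _ kt)// (leq_trans _ pt)//.
      by rewrite (leq_trans _ Kt)// leq_addl.
    by rewrite lerXn2r ?nnegrE// ler_nat.
  rewrite (le_trans (norm_universal_coef _ _))// exprD.
  rewrite (_ : 4 = 2 * 2 :> F) ?exprMn; last by rewrite -natrM.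
  by rewrite ler_wpM2l ?exprn_ge0// ler_eXn2l ?ltr1n.
exists x0; split=> //; last exact: dense_dist.
(* The orbit of 0 stays at distance [|z|] from a nonzero [z], whereas the orbit of [x0] comes
   closer. *)
apply/eqP => x00; have := norm_unit_coef 0.
set z := X_of_coef w (unit_coef 0) => zE.
have z0 : 0 < `|z| by rewrite zE normr_gt0 weight_neq0.
have [_ [n _ <-]] := d_orbit z `|z| z0.
rewrite (_ : act (op_pow B n) x0 = 0) ?subr0 ?ltxx//.
apply: (coef_inj hw) => k.
by rewrite (shift_operator_coef hw _ (shift_operator_pow hw n SB))// x00 !coef0.
Qed.

End words.

Lemma chaotic_shift_operator N B : (0 < N)%N -> shift_operator w N B ->
  chaotic B.
Proof.
move=> N0 SB; have [g gd] := dense_sequence_scalars R b.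
split; first exact: (hypercyclic_shift_operator gd N0 SB).
exact: (dense_periodic_points gd N0 SB).
Qed.

(** * Eigenvectors of the shift by one place *)

Section eigenvalues.
Variables (B : operator (X R b)) (l : F).
Hypothesis SB : shift_operator w 1 B.

Lemma wl1_geometric : wl1 w (GRing.exp l).
Proof.
by apply: (@wl1_exp _ _ _ hw _ 1 `|l|) => // k; rewrite mul1r normrX.
Qed.

Let e := X_of_coef w (GRing.exp l).

(** The eigenvalue equation reads u_(k+1) = l u_k, so the coefficients are geometric, and geometric
    sequences lie in the domain. The case [l = 0] is included, since [0 ^+ 0 = 1]. *)
Lemma eigenvector_coef x : op_ker (op_shift B l) x <->
  forall k, coef w x k = coef w x 0 * l ^+ k.
Proof.
split=> [[/= Bx /subr0_eq xl]|xE].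
  elim=> [|k IH]; first by rewrite expr0 mulr1.
  rewrite -addn1 -(shift_operator_coef hw _ SB)// xl.
  by rewrite coefZ IH addn1 exprS mulrCA.
have Bx : dom B x.
  have [-> _] := SB x.
  have := l1Z (a := coef w x 0 * l) wl1_geometric; congr l1; apply/funext => k.
  by rewrite (xE (k + 1)%N) addn1 exprS mulrCA -!mulrA.
split=> //=; apply/eqP; rewrite subr_eq0; apply/eqP/(coef_inj hw) => k.
rewrite (shift_operator_coef hw _ SB)// coefZ xE.
by rewrite [in RHS]xE addn1 exprS mulrCA.
Qed.

Lemma has_dim_eigenspace : has_dim (op_ker (op_shift B l)) 1.
Proof.
have eE := X_of_coefK hw wl1_geometric.
exists (fun=> e); split=> [c|].
  rewrite big_ord1 => /(congr1 (fun x => coef w x 0)).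
  by rewrite coefZ coef0 eE expr0 mulr1 => c0 i; rewrite ord1.
apply/seteqP; split=> x.
  move/eigenvector_coef => xE; exists (fun=> coef w x 0) => //.
  by rewrite big_ord1; apply: (coef_inj hw) => k; rewrite coefZ eE [RHS]xE.
move=> [c _ <-]; rewrite big_ord1; apply/eigenvector_coef => k.
by rewrite !coefZ !eE expr0 mulr1.
Qed.

Lemma point_spectrum_shift_operator : point_spectrum B l.
Proof.
have eE := X_of_coefK hw wl1_geometric.
have [Be /= el] : op_ker (op_shift B l) e.
  by apply/eigenvector_coef => k; rewrite !eE expr0 mul1r.
have [B0 /= zl] : op_ker (op_shift B l) 0.
  by apply/eigenvector_coef => k; rewrite !coef0 mul0r.
move=> /(_ e 0); rewrite !inE => /(_ Be B0); rewrite /= el zl => /(_ erefl).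
move=> /(congr1 (fun x => coef w x 0)); rewrite eE coef0 expr0.
by move/eqP; rewrite oner_eq0.
Qed.

End eigenvalues.
End chaos.

Theorem theorem6p2 (R : realType) (b : base_field) (w : scalars R b)
    (hw : 1 < `|w|) :
  [/\
    (* the formula defines a linear operator in X *)
    (forall x : X R b, dom (Ahat w) x ->
       (forall k, (0 < k)%N ->
          cvgn (fun N => \sum_(k <= j < N) Ahat_term w x j)) /\
       (act (Ahat w) x : nat -> scalars R b) = Ahat_seq w x) /\
    linear_operator (Ahat w),
    ~ bounded_operator (Ahat w) /\ chaotic (Ahat w),
    forall n : nat, (0 < n)%N ->
      [/\ dom (op_pow (Ahat w) n) = Ahat_pow_dom w n,
          forall x : X R b, dom (op_pow (Ahat w) n) x ->
            (forall k, (0 < k)%N ->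
               cvgn (fun N => \sum_(k <= j < N) Ahat_pow_term w n x j)) /\
            (act (op_pow (Ahat w) n) x : nat -> scalars R b) =
              Ahat_pow_seq w n x,
          ~ bounded_operator (op_pow (Ahat w) n) &
          chaotic (op_pow (Ahat w) n)],
    forall l : scalars R b,
      point_spectrum (Ahat w) l /\ has_dim (op_ker (op_shift (Ahat w) l)) 1 &
    b = ComplexField -> point_spectrum (Ahat w) = [set: scalars R b] ].
Proof.
have SA := shift_operator_Ahat hw.
have SAn n : shift_operator w n (op_pow (Ahat w) n).
  by rewrite -[X in shift_operator _ X _]muln1; exact: shift_operator_pow.
have domE n : dom (op_pow (Ahat w) n) = Ahat_pow_dom w n.
  apply/seteqP; split=> x.
    by move=> Ax; apply/Ahat_pow_domE => //; have [<-] := SAn n x.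
  by move/(Ahat_pow_domE hw) => lx; have [->] := SAn n x.
(* Also used with [n = 1] for the operator itself. *)
have formula n (x : X R b) : Ahat_pow_dom w n x ->
    (forall k, (0 < k)%N ->
      cvgn (fun N => \sum_(k <= j < N) Ahat_pow_term w n x j)) /\
    X_of_coef w (fun k => coef w x (k + n)%N) = Ahat_pow_seq w n x
      :> (nat -> _).
  move/(Ahat_pow_domE hw) => lx; split=> [[//|k] _|].
    by apply: cvgP; exact: Ahat_pow_sum_cvg.
  by rewrite X_of_coefE// Ahat_pow_seqE.
split.
- split; last exact: linear_shift_operator SA.
  move=> x Ax; have [_ ->//] := SA x.
  rewrite -Ahat_pow_term1 -Ahat_pow_seq1.
  by apply: formula; rewrite Ahat_pow_dom1.
- split; first exact: unbounded_shift_operator SA.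
  exact: chaotic_shift_operator SA.
- move=> n n0; split=> //.
  + move=> x Ax; have [_ ->//] := SAn n x.
    by apply: formula; rewrite -domE.
  + exact: unbounded_shift_operator (SAn n).
  + exact: chaotic_shift_operator (SAn n).
- move=> l; split; first exact: point_spectrum_shift_operator SA.
  exact: has_dim_eigenspace SA.
- move=> _; apply/seteqP; split=> // l _.
  exact: point_spectrum_shift_operator SA.
Qed.
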